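(* Let $a,b,c$ be positive numbers with $a<b<c$, $\lfloor c/b\rfloor\ge2$, $b-a<c_0<a$, $0<c_1<2a-b$, and $a/b\notin\mathbb Q$, where $c_0=c-\lfloor c/b\rfloor b$ and $c_1=c-c_0-\lfloor(c-c_0)/a\rfloor a$. Then $\mathcal S_{a,b,c}\ne\emptyset$ if and only if there exist nonnegative integers $d_1,d_2$ such that (1) $c-(d_1+1)(\lfloor c/b\rfloor+1)(b-a)-(d_2+1)\lfloor c/b\rfloor(b-a)\in a\mathbb Z$; (2) $\lfloor c/b\rfloor b+(d_1+1)(b-a)<c<\lfloor c/b\rfloor b+b-(d_2+1)(b-a)$; (3) $\#E_{a,b,c}=d_1$, where, with $m=\big((d_1+d_2+1)c_1-c_0+(d_1+1)(b-a)\big)/a$, $E_{a,b,c}=\{n\in\mathbb Z\cap[1,d_1+d_2+1]: n(c_1-m(b-a))\in[0,c_0-(d_1+1)(b-a))+(a-(d_1+d_2+1)(b-a))\mathbb Z\}$.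
   Context: For $a,b,c>0$ and $t\in\mathbb R$, $\mathbf M_{a,b,c}(t)=(\chi_{[0,c)}(t-\mu+\lambda))_{\mu\in a\mathbb Z,\lambda\in b\mathbb Z}$ is the infinite matrix with rows indexed by $a\mathbb Z$ and columns by $b\mathbb Z$, acting by $(\mathbf M_{a,b,c}(t)\mathbf x)(\mu)=\sum_{\lambda\in b\mathbb Z}\chi_{[0,c)}(t-\mu+\lambda)\mathbf x(\lambda)$. $\mathcal B_b^0$ is the set of vectors $(\mathbf x(\lambda))_{\lambda\in b\mathbb Z}$ with entries in $\{0,1\}$ and $\mathbf x(0)=1$. $\mathbf 1$ denotes the vector indexed by $a\mathbb Z$ with all entries $1$. $\mathcal S_{a,b,c}=\{t:\mathbf M_{a,b,c}(t)\mathbf x=\mathbf 1\text{ for some }\mathbf x\in\mathcal B_b^0\}$. $\#$ denotes cardinality and $A+r\mathbb Z=\{x+rk:x\in A,k\in\mathbb Z\}$. *)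

(* Defs.v *)
From Stdlib Require Import Reals ZArith List.
Open Scope R_scope.

(* floor function: Int_part x = up x - 1 is the greatest integer <= x *)
Definition rfloor (x : R) : Z := Int_part x.

Definition in_Ico0 (c x : R) : Prop := 0 <= x < c.

(* t in S_{a,b,c}: there is x in B_b^0 (a 0/1 vector indexed by bZ, x(0)=1,
   here x k is the entry at lambda = b k) such that M_{a,b,c}(t) x = 1, i.e.
   for every row mu = a j the 0/1 sum  sum_k chi_[0,c)(t - a j + b k) x(b k)
   equals 1, i.e. exactly one k contributes a nonzero term. *)
Definition in_S (a b c t : R) : Prop :=
  exists x : Z -> bool, x 0%Z = true /\
    forall j : Z, exists! k : Z,
      x k = true /\ in_Ico0 c (t - a * IZR j + b * IZR k).

Definition S_nonempty (a b c : R) : Prop := exists t : R, in_S a b c t.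

Definition rational (x : R) : Prop :=
  exists p q : Z, q <> 0%Z /\ x = IZR p / IZR q.

Definition in_multZ (r x : R) : Prop := exists k : Z, x = IZR k * r.

Definition in_Ico_mod (lo hi r x : R) : Prop :=
  exists k : Z, lo <= x - IZR k * r < hi.

Definition Zcard (P : Z -> Prop) (n : nat) : Prop :=
  exists l : list Z, NoDup l /\ (forall z, In z l <-> P z) /\ length l = n.

Definition c0_of (a b c : R) : R := c - IZR (rfloor (c / b)) * b.
Definition c1_of (a b c : R) : R :=
  c - c0_of a b c - IZR (rfloor ((c - c0_of a b c) / a)) * a.

Definition m_of (a b c : R) (d1 d2 : nat) : R :=
  ((INR (d1 + d2 + 1)) * c1_of a b c - c0_of a b c + INR (d1 + 1) * (b - a)) / a.

Definition E_set (a b c : R) (d1 d2 : nat) (n : Z) : Prop :=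
  (1 <= n <= Z.of_nat (d1 + d2 + 1))%Z /\
  in_Ico_mod 0 (c0_of a b c - INR (d1 + 1) * (b - a))
             (a - INR (d1 + d2 + 1) * (b - a))
             (IZR n * (c1_of a b c - m_of a b c d1 d2 * (b - a))).

(* Main.v *)
Require Import Defs.
From Stdlib Require Import Reals ZArith List Lra Lia Classical ClassicalEpsilon.
Open Scope R_scope.

(** Write [beta = b - a].  If [t] lies in [S_{a,b,c}], consecutive points of the support
    of the vector are related, modulo [a], by the map that cuts the hole
    [[c0 - beta, c0)] out of the circle [R / aZ], opens a hole of the same length after
    [0], and rotates by [c1].  This map preserves the cyclic order and, since [a / b] is
    irrational, has no periodic points.  On the (right-closed) set of surviving points,
    the gaps are transported isometrically except that [beta] is gained at [0] and lost
    at [c0]; as infinitely many gaps of equal length do not fit on the circle, there is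
    no gap before [0], the gap before [c0] is exactly the hole, and the orbit of [0]
    reaches [c0] after [D = d1 + d2 + 1] steps, [d1] of which start strictly between [0]
    and the hole.  Collapsing the [D] gaps conjugates the map to the rotation by
    [c1 - m beta] on a circle of length [a - D beta], which gives (1)-(3).  Conversely,
    (1)-(3) allow one to re-insert [D] gaps into this rotation, and the orbit of [0]
    then avoids the hole. *)

(** * Floors in units of [a], integer sums, counting in lists *)

Definition fl (a x : R) : Z := Int_part (x / a).

Lemma fl_spec (a x : R) : 0 < a -> IZR (fl a x) * a <= x < IZR (fl a x) * a + a.
Proof.
  intros Ha. unfold fl. destruct (base_Int_part (x / a)) as [H1 H2].
  set (z := IZR (Int_part (x / a))) in *.
  replace x with (x / a * a) by (field; lra).
  split; nra.
Qed.

Lemma fl_unique (a x : R) (z : Z) :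
  0 < a -> IZR z * a <= x < IZR z * a + a -> fl a x = z.
Proof.
  intros Ha [H1 H2]. symmetry. apply Int_part_spec.
  assert (E : x / a * a = x) by (field; lra). nra.
Qed.

Lemma fl_shift (a x : R) (z : Z) : 0 < a -> fl a (x + IZR z * a) = (fl a x + z)%Z.
Proof.
  intros Ha. apply fl_unique; trivial. rewrite plus_IZR.
  pose proof (fl_spec a x Ha). lra.
Qed.

Lemma fl_right_constant (a v : R) :
  0 < a -> exists e, 0 < e /\ forall x, v <= x < v + e -> fl a x = fl a v.
Proof.
  intros Ha. pose proof (fl_spec a v Ha) as Hv.
  exists (IZR (fl a v) * a + a - v). split; [lra|].
  intros x Hx. apply fl_unique; trivial. lra.
Qed.

(* [zsum f n] is the sum of [f i] for [1 <= i <= n]. *)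
Fixpoint zsum (f : nat -> Z) (n : nat) : Z :=
  match n with O => 0%Z | S k => (zsum f k + f (S k))%Z end.

Lemma zsum_ext (f g : nat -> Z) (n : nat) :
  (forall i, (1 <= i <= n)%nat -> f i = g i) -> zsum f n = zsum g n.
Proof.
  induction n as [|n IH]; intros H; simpl; trivial.
  rewrite IH, H by (intros; try apply H; lia). reflexivity.
Qed.

Lemma zsum_plus (f g : nat -> Z) (n : nat) :
  zsum (fun i => (f i + g i)%Z) n = (zsum f n + zsum g n)%Z.
Proof. induction n; simpl; lia. Qed.

Lemma zsum_const (z : Z) (n : nat) : zsum (fun _ => z) n = (Z.of_nat n * z)%Z.
Proof. induction n as [|n IH]; simpl zsum; [lia|]. rewrite IH. lia. Qed.

Lemma zsum_pred (f : nat -> Z) (n : nat) :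
  zsum (fun i => f (pred i)) n = (zsum f n + f O - f n)%Z.
Proof. induction n as [|n IH]; simpl; [lia|]. rewrite IH. lia. Qed.

Lemma zsum_bool (p : nat -> bool) (n : nat) :
  zsum (fun i => if p i then 1%Z else 0%Z) n = Z.of_nat (length (filter p (seq 1 n))).
Proof.
  induction n as [|n IH]; simpl zsum; trivial.
  rewrite IH, seq_S, filter_app, length_app. simpl.
  destruct (p (S n)); simpl; lia.
Qed.

Lemma filter_length_plus (A : Type) (p q r : A -> bool) (l : list A) :
  (forall x, In x l -> ((if p x then 1 else 0) + (if q x then 1 else 0) = if r x then 1 else 0)%nat) ->
  (length (filter p l) + length (filter q l) = length (filter r l))%nat.
Proof.
  induction l as [|x l IH]; intros H; simpl; trivial.
  pose proof (H x (or_introl eq_refl)) as Hx.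
  assert (Hl : forall y, In y l -> ((if p y then 1 else 0) + (if q y then 1 else 0) = if r y then 1 else 0)%nat)
    by (intros y Hy; apply H; right; trivial).
  specialize (IH Hl). destruct (p x), (q x), (r x); simpl in *; lia.
Qed.

Definition ltb (x y : R) : bool := if Rlt_dec x y then true else false.

Lemma ltb_spec (x y : R) : reflect (x < y) (ltb x y).
Proof. unfold ltb. destruct (Rlt_dec x y); constructor; trivial. Qed.

Lemma list_max_exists (l : list R) :
  l <> nil -> exists w, In w l /\ forall z, In z l -> z <= w.
Proof.
  induction l as [|x l IH]; intros H; [congruence|].
  destruct l as [|y l].
  - exists x. split; [left; trivial|]. intros z [<-|[]]. lra.
  - destruct IH as [w [Hw Hm]]; [congruence|].
    destruct (Rle_dec x w).
    + exists w. split; [right; trivial|]. intros z [<-|Hz]; auto.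
    + exists x. split; [left; trivial|]. intros z [<-|Hz]; [lra|].
      specialize (Hm z Hz). lra.
Qed.

(** * Packing of gaps on the line *)

Definition gap (X : R -> Prop) (d v : R) : Prop :=
  forall s, X s -> s < v -> s <= v - d.

(** Remove the largest point [w]: its gap confines the other points to [(x, w - d]], where induction
    applies. Equality would force the lowest point to be [x + d], hence the strict form. *)
Lemma gap_packing (X : R -> Prop) (d : R) (l : list R) : forall x y,
  0 <= d -> NoDup l -> X x -> x <= y ->
  (forall w, In w l -> x < w <= y /\ X w /\ gap X d w) ->
  x + d * INR (length l) <= y /\
  (l <> nil -> ~ In (x + d) l -> x + d * INR (length l) < y).
Proof.
  remember (length l) as n eqn:En. revert l En.
  induction n as [|n IH]; intros l En x y Hd Hnd Hx Hxy Hl.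
  - split; [simpl; lra|]. destruct l; [congruence|discriminate].
  - destruct (list_max_exists l) as [w [Hw Hm]]; [destruct l; discriminate|].
    destruct (in_split _ _ Hw) as [l1 [l2 El]]. subst l.
    destruct (NoDup_remove _ _ _ Hnd) as [Hnd' Hnw].
    assert (Hwx : x <= w - d) by (apply Hl; trivial; apply Hl; trivial).
    assert (Hin : forall z, In z (l1 ++ l2) -> In z (l1 ++ w :: l2)).
    { intros z Hz. apply in_app_iff in Hz. apply in_app_iff. simpl. tauto. }
    assert (Hy : w <= y) by (apply Hl; trivial).
    destruct (IH (l1 ++ l2)) with (x := x) (y := w - d) as [I1 I2]; trivial.
    + rewrite length_app in *. simpl in En. lia.
    + intros z Hz. pose proof (Hin z Hz) as Hz'.
      destruct (Hl z Hz') as [H1 [H2 H3]].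
      split; [|split; trivial]. split; [lra|].
      apply (Hl w Hw); trivial.
      pose proof (Hm z Hz'). destruct (Req_dec z w); [congruence|lra].
    + rewrite S_INR. split; [nra|]. intros _ Hnin.
      destruct (l1 ++ l2) as [|z l'] eqn:E.
      * apply app_eq_nil in E. destruct E. subst l1 l2. simpl in En.
        injection En as ->.
        assert (w <> x + d) by congruence. simpl. lra.
      * assert (x + d * INR n < w - d); [|lra].
        apply I2; [discriminate|]. intros H. apply Hnin. apply Hin. trivial.
Qed.

(** * The circle map, lifted to the line *)

Section CircleMap.

Variables a beta c0 c1 : R.
Hypothesis beta_pos : 0 < beta.
Hypothesis c0_bounds : beta < c0 < a.

(** The indicator of [[0, c0)] modulo [a]; written as a difference of floors, it cancels against a
    telescoping sum in [collapse_F]. *)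
Definition bit (x : R) : Z := (fl a x - fl a (x - c0))%Z.
Definition F (x : R) : R := x + c1 + beta * IZR (bit x).

Lemma bit_cases (x : R) :
  (bit x = 1%Z /\ x < IZR (fl a x) * a + c0) \/
  (bit x = 0%Z /\ IZR (fl a x) * a + c0 <= x).
Proof.
  assert (Ha : 0 < a) by lra.
  pose proof (fl_spec a x Ha) as Hx. unfold bit.
  destruct (Rlt_le_dec x (IZR (fl a x) * a + c0)) as [H|H]; [left|right]; split; trivial.
  - rewrite (fl_unique a (x - c0) (fl a x - 1)); trivial; [lia|].
    rewrite minus_IZR. lra.
  - rewrite (fl_unique a (x - c0) (fl a x)); trivial; [lia|]. lra.
Qed.

Lemma bit_shift (x : R) (z : Z) : bit (x + IZR z * a) = bit x.
Proof.
  assert (Ha : 0 < a) by lra. unfold bit.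
  replace (x + IZR z * a - c0) with (x - c0 + IZR z * a) by ring.
  rewrite !fl_shift by trivial. lia.
Qed.

Lemma F_shift (x : R) (z : Z) : F (x + IZR z * a) = F x + IZR z * a.
Proof. unfold F. rewrite bit_shift. ring. Qed.

Lemma bit_right_constant (v : R) :
  exists e, 0 < e /\ forall x, v <= x < v + e -> bit x = bit v.
Proof.
  assert (Ha : 0 < a) by lra.
  destruct (fl_right_constant a v Ha) as [e1 [He1 H1]].
  destruct (fl_right_constant a (v - c0) Ha) as [e2 [He2 H2]].
  exists (Rmin e1 e2). split; [apply Rmin_glb_lt; trivial|].
  intros x Hx. pose proof (Rmin_l e1 e2). pose proof (Rmin_r e1 e2).
  unfold bit. rewrite (H1 x), (H2 (x - c0)) by lra. reflexivity.
Qed.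

Lemma bit_nonneg (x : R) : (0 <= bit x)%Z.
Proof. destruct (bit_cases x) as [[-> _]|[-> _]]; lia. Qed.

Definition orbit (n : nat) (x : R) : R := Nat.iter n F x.

Fixpoint visits (n : nat) (x : R) : Z :=
  match n with O => 0%Z | S k => (visits k x + bit (orbit k x))%Z end.

Lemma orbit_formula (n : nat) (x : R) :
  orbit n x = x + INR n * c1 + beta * IZR (visits n x).
Proof.
  induction n as [|n IH]; [simpl; ring|].
  rewrite S_INR. simpl visits. rewrite plus_IZR.
  change (orbit (S n) x) with (F (orbit n x)). unfold F at 1. rewrite IH at 1. ring.
Qed.

Lemma visits_mono (x : R) (n k : nat) : (n <= k)%nat -> (visits n x <= visits k x)%Z.
Proof.
  induction 1 as [|k _ IH]; [lia|]. simpl. pose proof (bit_nonneg (orbit k x)). lia.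
Qed.

(* Removing the arc [c0 - beta, c0) and opening an arc of the same length after 0
   preserves the cyclic order. *)
Definition off_hole (x : R) : Prop :=
  x < IZR (fl a x) * a + c0 - beta \/ IZR (fl a x) * a + c0 <= x.

(** Order is at risk only when [x] gets the extra [beta] and [y] does not; then an arc
    [[c0 - beta, c0)] separates them, so [y - x] exceeds [beta]. *)
Lemma F_strict_mono (x y : R) : off_hole x -> x < y -> F x < F y.
Proof.
  intros Hx Hxy. assert (Ha : 0 < a) by lra. unfold F.
  destruct (bit_cases x) as [[-> Bx]|[-> Bx]]; destruct (bit_cases y) as [[-> By]|[-> By]]; try lra.
  assert (Hle : IZR (fl a x) <= IZR (fl a y)).
  { apply IZR_le. destruct (Z_le_gt_dec (fl a x) (fl a y)) as [H|H]; trivial.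
    exfalso. assert (IZR (fl a y) + 1 <= IZR (fl a x)) by (rewrite <- plus_IZR; apply IZR_le; lia).
    pose proof (fl_spec a x Ha). pose proof (fl_spec a y Ha). nra. }
  destruct Hx; [nra|lra].
Qed.

Lemma F_mono (x y : R) : off_hole x -> x <= y -> F x <= F y.
Proof.
  intros Hx [Hxy| ->]; [|lra]. left. apply F_strict_mono; trivial.
Qed.

(** * Gaps of an invariant set *)

Section InvariantSet.

Variable X : R -> Prop.
Hypothesis X_shift : forall x z, X x -> X (x + IZR z * a).
Hypothesis X_off_hole : forall x, X x -> off_hole x.
Hypothesis X_fwd : forall x, X x -> X (F x).
Hypothesis X_bwd : forall x, X x -> exists y, X y /\ F y = x.
Hypothesis X_min : forall r, exists v, X v /\ r <= v /\ forall x, X x -> r <= x -> v <= x.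
Hypothesis X_aperiodic :
  forall x i j z, X x -> orbit i x = orbit j x + IZR z * a -> i = j.

Lemma F_lt_inv (x y : R) : X x -> X y -> F x < F y -> x < y.
Proof.
  intros Hx Hy H. destruct (Rlt_le_dec x y) as [|Hle]; trivial.
  apply F_mono in Hle; auto. lra.
Qed.

(** [F] is increasing on [X] and commutes with translation by [a], so it preserves the number of
    whole turns between two points. *)
Lemma fl_F_diff (x y : R) : X x -> X y -> fl a (F x - F y) = fl a (x - y).
Proof.
  intros Hx Hy. assert (Ha : 0 < a) by lra.
  pose proof (fl_spec a (x - y) Ha) as [H1 H2].
  set (l := fl a (x - y)) in *. apply fl_unique; trivial. split.
  - assert (F (y + IZR l * a) <= F x) by (apply F_mono; auto; lra).
    rewrite F_shift in *. lra.
  - assert (F x < F (y + IZR (l + 1) * a)).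
    { apply F_strict_mono; auto. rewrite plus_IZR. lra. }
    rewrite F_shift, plus_IZR in *. lra.
Qed.

Lemma X_orbit (n : nat) (x : R) : X x -> X (orbit n x).
Proof. intros Hx. induction n; simpl; auto. Qed.

Lemma gap_shift (d v : R) (z : Z) : gap X d v -> gap X d (v + IZR z * a).
Proof.
  intros H s Hs Hlt. specialize (H (s + IZR (- z) * a) (X_shift _ _ Hs)).
  rewrite opp_IZR in H. lra.
Qed.

(** Reduced modulo [a], the points stay distinct in [[0, a)]; more than [2 a / d] gaps do not fit
    between a point of [X] in [[-a, 0)] and [a]. *)
Lemma no_infinite_gap_sequence (d : R) (w : nat -> R) :
  0 < d -> (forall n, X (w n)) -> (forall n, gap X d (w n)) ->
  (forall i j z, w i = w j + IZR z * a -> i = j) -> False.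
Proof.
  intros Hd HX Hg Hinj. assert (Ha : 0 < a) by lra.
  destruct (X_min (- 2 * a)) as [x [Hx _]].
  set (x' := x + IZR (- fl a x - 1) * a).
  assert (Hx' : X x') by (apply X_shift; trivial).
  assert (Hb : - a <= x' < 0).
  { unfold x'. rewrite minus_IZR, opp_IZR. pose proof (fl_spec a x Ha). lra. }
  set (u := fun n => w n + IZR (- fl a (w n)) * a).
  assert (Hub : forall n, 0 <= u n < a).
  { intros n. unfold u. rewrite opp_IZR. pose proof (fl_spec a (w n) Ha). lra. }
  destruct (INR_archimed d (2 * a) Hd) as [n Hn].
  destruct (gap_packing X d (map u (seq 0 n)) x' a) as [H _]; try lra; trivial.
  - apply NoDup_map_NoDup_ForallPairs; [|apply seq_NoDup].
    intros i j _ _ E. unfold u in E.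
    apply (Hinj i j (- fl a (w j) - - fl a (w i))%Z). rewrite minus_IZR. lra.
  - intros y Hy. apply in_map_iff in Hy. destruct Hy as [i [<- _]].
    specialize (Hub i). split; [lra|]. split; [apply X_shift; auto|apply gap_shift; auto].
  - rewrite length_map, length_seq in H. lra.
Qed.

(** A gap can shrink only if [w] has bit 0 and a point [y] on its left has bit 1. Then the translate
    of [vH] in the cell of [w] lies between them, moves rigidly with [w], and keeps the image of [y]
    at distance [d]. *)
Lemma gap_fwd (vH d w : R) :
  X vH -> c0 <= vH -> (forall x, X x -> c0 <= x -> vH <= x) ->
  X w -> gap X d w -> 0 <= d -> (forall z, w <> vH + IZR z * a) -> gap X d (F w).
Proof.
  intros HvX Hv Hmin Hw Hg Hd Hne s Hs Hlt. assert (Ha : 0 < a) by lra.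
  destruct (X_bwd s Hs) as [y [Hy <-]].
  assert (Hyw : y < w) by (apply F_lt_inv; trivial).
  assert (Hyd : y <= w - d) by (apply Hg; trivial).
  destruct (bit_cases w) as [[Bw Cw]|[Bw Cw]].
  { unfold F. rewrite Bw. destruct (bit_cases y) as [[-> _]|[-> _]]; lra. }
  destruct (bit_cases y) as [[By Cy]|[By Cy]]; [|unfold F; rewrite Bw, By; lra].
  set (v := vH + IZR (fl a w) * a).
  assert (HvX' : X v) by (apply X_shift; trivial).
  assert (Hvw : v < w).
  { assert (vH <= w + IZR (- fl a w) * a) by
      (apply Hmin; [apply X_shift; trivial|rewrite opp_IZR; lra]).
    rewrite opp_IZR in *. specialize (Hne (fl a w)). fold v in Hne.
    unfold v in *. lra. }
  assert (Bv : bit v = 0%Z).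
  { assert (Ev : fl a v = fl a w).
    { apply fl_unique; trivial. pose proof (fl_spec a w Ha). unfold v in *. lra. }
    destruct (bit_cases v) as [[_ Cv]|[Bv _]]; trivial.
    rewrite Ev in Cv. unfold v in *. lra. }
  assert (Hvd : v <= w - d) by (apply Hg; trivial).
  assert (Hyv : y <= v).
  { destruct (Rle_dec y v) as [|n]; trivial. exfalso.
    assert (Ey : fl a y = fl a w).
    { apply fl_unique; trivial. pose proof (fl_spec a w Ha). unfold v in *. lra. }
    rewrite Ey in Cy. unfold v in *. lra. }
  assert (F y <= F v) by (apply F_mono; auto).
  unfold F in *. rewrite Bw, Bv in *. lra.
Qed.

(** The dual situation: [F] lengthens a gap only if [y] has bit 1 and the point on its left has bit
    0; then the translate of [v0] in the cell of [y] lies between and moves rigidly with [y]. *)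
Lemma gap_bwd (v0 d y : R) :
  X v0 -> 0 <= v0 -> (forall x, X x -> 0 <= x -> v0 <= x) ->
  X y -> gap X d (F y) -> 0 <= d -> (forall z, y <> v0 + IZR z * a) -> gap X d y.
Proof.
  intros HvX Hv Hmin Hy Hg Hd Hne s Hs Hlt. assert (Ha : 0 < a) by lra.
  assert (HF : F s < F y) by (apply F_strict_mono; auto).
  assert (HFd : F s <= F y - d) by (apply Hg; auto).
  destruct (bit_cases s) as [[Bs Cs]|[Bs Cs]].
  { unfold F in *. rewrite Bs in *. destruct (bit_cases y) as [[E _]|[E _]]; rewrite E in *; lra. }
  destruct (bit_cases y) as [[By Cy]|[By Cy]]; [|unfold F in *; rewrite By, Bs in *; lra].
  set (v := v0 + IZR (fl a y) * a).
  assert (HvX' : X v) by (apply X_shift; trivial).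
  pose proof (fl_spec a y Ha) as Sy.
  assert (Hvy : v < y).
  { assert (v0 <= y + IZR (- fl a y) * a) by
      (apply Hmin; [apply X_shift; trivial|rewrite opp_IZR; lra]).
    rewrite opp_IZR in *. specialize (Hne (fl a y)). fold v in Hne.
    unfold v in *. lra. }
  assert (Bv : bit v = 1%Z).
  { assert (Ev : fl a v = fl a y).
    { apply fl_unique; trivial. unfold v in *. lra. }
    destruct (bit_cases v) as [[Bv _]|[_ Cv]]; trivial.
    rewrite Ev in Cv. unfold v in *. lra. }
  assert (F v < F y) by (apply F_strict_mono; auto).
  assert (Hvd : F v <= F y - d) by (apply Hg; auto).
  assert (Hsv : s <= v).
  { destruct (Rle_dec s v) as [|n]; trivial. exfalso.
    assert (Ey : fl a s = fl a y).
    { apply fl_unique; trivial. unfold v in *. lra. }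
    rewrite Ey in Cs. unfold v in *. lra. }
  unfold F in *. rewrite By, Bv in *. lra.
Qed.

(* A larger gap in front of c0 would survive, shortened by beta, along the whole
   forward orbit. *)
Lemma c0_in_X : X c0.
Proof.
  destruct (X_min c0) as [v [HvX [Hv Hmin]]].
  destruct (Req_dec v c0) as [<-|Hne]; trivial. exfalso.
  assert (Ha : 0 < a) by lra.
  assert (Hd : 0 < v - c0) by lra.
  apply (no_infinite_gap_sequence (v - c0) (fun n => orbit (S n) v)); trivial.
  - intros n. apply X_orbit; trivial.
  - induction n as [|n IH].
    + intros s Hs Hlt. destruct (X_bwd s Hs) as [y [Hy <-]].
      change (orbit 1 v) with (F v) in *.
      assert (Hyv : y < v) by (apply F_lt_inv; trivial).
      assert (Hyc : y < c0).
      { destruct (Rlt_le_dec y c0) as [|Hle]; trivial. specialize (Hmin y Hy Hle). lra. }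
      (* The point [y] lies even below the hole, so [v - y] exceeds [v - c0 + beta], of which the
         map takes away at most [beta]. *)
      assert (Hyh : y < c0 - beta).
      { destruct (Rlt_le_dec y (c0 - beta)) as [|Hle]; trivial. exfalso.
        assert (E : fl a y = 0%Z) by (apply fl_unique; trivial; simpl; lra).
        destruct (X_off_hole y Hy) as [H|H]; rewrite E in H; simpl in H; lra. }
      unfold F. destruct (bit_cases v) as [[-> _]|[-> _]];
        destruct (bit_cases y) as [[-> _]|[-> _]]; lra.
    + change (orbit (S (S n)) v) with (F (orbit (S n) v)).
      apply (gap_fwd v); trivial; try lra. { apply X_orbit; trivial. }
      intros z E. apply (X_aperiodic v (S n) 0 z) in E; trivial. discriminate.
  - intros i j z E. apply X_aperiodic in E; trivial. lia.
Qed.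

(* A gap in front of 0 would persist along the whole backward orbit. *)
Lemma zero_in_X : X 0.
Proof.
  destruct (X_min 0) as [v [HvX [Hv Hmin]]].
  destruct (Req_dec v 0) as [<-|Hne]; trivial. exfalso.
  assert (Hd : 0 < v) by lra.
  (* [B] chooses a preimage in [X], which makes [w] a backward orbit of [v]. *)
  set (B := fun x => epsilon (inhabits 0) (fun y => X y /\ F y = x)).
  assert (HB : forall x, X x -> X (B x) /\ F (B x) = x).
  { intros x Hx. apply epsilon_spec. apply X_bwd; trivial. }
  set (w := fun n => Nat.iter n B v).
  assert (HwX : forall n, X (w n)).
  { induction n; simpl; trivial. apply HB; trivial. }
  assert (HwF : forall n, F (w (S n)) = w n) by (intros n; apply HB; apply HwX).
  assert (Hor : forall k n, orbit k (w (k + n)%nat) = w n).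
  { induction k as [|k IH]; intros n; trivial.
    change (orbit (S k) (w (S k + n)%nat)) with (F (orbit k (w (S k + n)%nat))).
    replace (S k + n)%nat with (k + S n)%nat by lia. rewrite IH. apply HwF. }
  assert (Hinj : forall i j z, w i = w j + IZR z * a -> i = j).
  { intros i j z E.
    (* Both [w i] and [w j] are forward iterates of [w (i + j)], to which aperiodicity applies. *)
    assert (Ei : orbit j (w (i + j)%nat) = w i) by (rewrite Nat.add_comm; apply Hor).
    assert (Ej : orbit i (w (i + j)%nat) = w j) by apply Hor.
    rewrite <- Ei, <- Ej in E. apply X_aperiodic in E; auto. }
  apply (no_infinite_gap_sequence v w); trivial.
  induction n as [|n IH].
  - intros s Hs Hlt. simpl in *. destruct (Rle_dec s 0); [lra|].
    assert (v <= s) by (apply Hmin; trivial; lra). lra.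
  - apply (gap_bwd v); trivial; try lra. { rewrite HwF; trivial. }
    intros z E. apply (Hinj (S n) O z) in E. discriminate.
Qed.

(** A point of [X] left of 0 either has bit 0 and falls behind by [beta], or has bit 1 and, being
    off the hole of an earlier cell, is already below [- beta]. *)
Lemma gap_after_zero : gap X beta (F 0).
Proof.
  assert (Ha : 0 < a) by lra.
  intros s Hs Hlt. destruct (X_bwd s Hs) as [y [Hy <-]].
  assert (Hy0 : y < 0) by (apply F_lt_inv; trivial; apply zero_in_X).
  assert (E0 : fl a 0 = 0%Z) by (apply fl_unique; trivial; simpl; lra).
  unfold F. destruct (bit_cases 0) as [[-> _]|[_ C]]; [|rewrite E0 in C; simpl in C; lra].
  destruct (bit_cases y) as [[-> C]|[-> C]]; [|lra].
  destruct (X_off_hole y Hy) as [H|H]; [|lra].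
  assert (IZR (fl a y) <= -1).
  { apply IZR_le. destruct (Z_le_gt_dec (fl a y) (-1)) as [|G]; trivial. exfalso.
    assert (0 <= IZR (fl a y)) by (apply IZR_le; lia).
    pose proof (fl_spec a y Ha). nra. }
  nra.
Qed.

(* The orbit of 0 creates a gap of length beta at every step until it reaches c0. *)
Lemma orbit_zero_reaches_c0 :
  exists (D : nat) (m : Z), (1 <= D)%nat /\ orbit D 0 = c0 + IZR m * a /\
    forall n, (1 <= n <= D)%nat -> gap X beta (orbit n 0).
Proof.
  pose proof zero_in_X as H0. pose proof c0_in_X as Hc.
  assert (Hstep : forall n, (forall i z, (1 <= i <= n)%nat -> orbit i 0 <> c0 + IZR z * a) ->
                            gap X beta (orbit (S n) 0)).
  { induction n as [|n IH]; intros Hn.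
    - apply gap_after_zero.
    - change (orbit (S (S n)) 0) with (F (orbit (S n) 0)).
      apply (gap_fwd c0); trivial; try lra.
      + apply X_orbit; trivial.
      + apply IH. intros i z Hi. apply Hn. lia.
      + intros z. apply Hn. lia. }
  assert (Hex : exists n z, (1 <= n)%nat /\ orbit n 0 = c0 + IZR z * a).
  { apply NNPP. intros Hno.
    apply (no_infinite_gap_sequence beta (fun n => orbit (S n) 0)); trivial.
    - intros n. apply X_orbit; trivial.
    - intros n. apply Hstep. intros i z Hi E. apply Hno. exists i, z. split; [lia|trivial].
    - intros i j z E. apply X_aperiodic in E; trivial. lia. }
  destruct Hex as [D [m [HD E]]]. exists D, m. split; [trivial|split; [trivial|]].
  intros n Hn. replace n with (S (pred n)) by lia. apply Hstep.
  (* By aperiodicity the orbit meets [c0] modulo [a] at time [D] only, so no gap is shortened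
     before. *)
  intros i z Hi Ei.
  assert (i = D); [|lia].
  apply (X_aperiodic 0 i D (z - m)%Z); trivial. rewrite Ei, E, minus_IZR. ring.
Qed.

(** * Counting the gaps along the orbit of 0 *)

Section Counting.

Variables (D : nat) (m : Z).
Hypothesis D_pos : (1 <= D)%nat.
Hypothesis orbit_D : orbit D 0 = c0 + IZR m * a.
Hypothesis orbit_gap : forall n, (1 <= n <= D)%nat -> gap X beta (orbit n 0).
Hypothesis orbit_not_adjacent : forall i j z, orbit i 0 <> orbit j 0 + beta + IZR z * a.

Definition res (n : nat) : R := orbit n 0 + IZR (- fl a (orbit n 0)) * a.

(** The inequality [res n <= x] is weak because each gap lies immediately before its orbit point. *)
Definition count_below (x : R) : nat :=
  length (filter (fun n => negb (ltb x (res n))) (seq 1 D)).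

Lemma res_bounds (n : nat) : 0 <= res n < a.
Proof.
  assert (Ha : 0 < a) by lra. unfold res. rewrite opp_IZR.
  pose proof (fl_spec a (orbit n 0) Ha). lra.
Qed.

Lemma res_0 : res 0 = 0.
Proof.
  assert (Ha : 0 < a) by lra. unfold res. simpl orbit.
  rewrite (fl_unique a 0 0) by (simpl; lra). simpl. ring.
Qed.

Lemma res_D : res D = c0.
Proof.
  assert (Ha : 0 < a) by lra. unfold res. rewrite orbit_D.
  rewrite fl_shift, (fl_unique a c0 0) by (simpl; lra).
  rewrite opp_IZR, plus_IZR. simpl. ring.
Qed.

Lemma res_inj (i j : nat) : res i = res j -> i = j.
Proof.
  intros E. unfold res in E. rewrite !opp_IZR in E.
  apply (X_aperiodic 0 i j (fl a (orbit i 0) - fl a (orbit j 0))%Z).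
  - apply zero_in_X.
  - rewrite minus_IZR. lra.
Qed.

Lemma res_not_adjacent (i j : nat) : res i <> res j + beta.
Proof.
  intros E. unfold res in E. rewrite !opp_IZR in E.
  apply (orbit_not_adjacent i j (fl a (orbit i 0) - fl a (orbit j 0))%Z).
  rewrite minus_IZR. lra.
Qed.

Lemma X_res (n : nat) : X (res n).
Proof. apply X_shift, X_orbit, zero_in_X. Qed.

Lemma bit_orbit (n : nat) : bit (orbit n 0) = if ltb (res n) c0 then 1%Z else 0%Z.
Proof.
  unfold res. rewrite opp_IZR.
  destruct (ltb_spec (orbit n 0 + - IZR (fl a (orbit n 0)) * a) c0);
  destruct (bit_cases (orbit n 0)) as [[-> C]|[-> C]]; trivial; lra.
Qed.

(** Strict because no two orbit points differ by exactly [beta] modulo [a], so the gaps cannot fill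
    the interval. *)
Lemma res_packing (j : nat) (y : R) :
  res j < y ->
  beta * INR (length (filter (fun n => andb (ltb (res j) (res n)) (negb (ltb y (res n)))) (seq 1 D)))
    < y - res j.
Proof.
  intros Hy. set (l := filter _ _).
  assert (Hl : forall n, In n l -> (1 <= n <= D)%nat /\ res j < res n <= y).
  { intros n Hn. apply filter_In in Hn. destruct Hn as [H1 H2]. apply in_seq in H1.
    apply andb_prop in H2. destruct H2 as [H2 H3].
    destruct (ltb_spec (res j) (res n)), (ltb_spec y (res n)); try discriminate.
    split; [lia|lra]. }
  destruct (gap_packing X beta (map res l) (res j) y) as [_ H]; try lra.
  - apply NoDup_map_NoDup_ForallPairs; [intros i k _ _; apply res_inj|].
    apply NoDup_filter, seq_NoDup.
  - apply X_res.
  - intros w Hw. apply in_map_iff in Hw. destruct Hw as [n [<- Hn]].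
    destruct (Hl n Hn) as [H1 H2]. split; trivial. split; [apply X_res|].
    apply gap_shift, orbit_gap; trivial.
  - rewrite length_map in H. destruct l as [|n l]; [simpl; lra|].
    assert (res j + beta * INR (length (n :: l)) < y); [|lra].
    apply H; [discriminate|]. intros Hin. apply in_map_iff in Hin.
    destruct Hin as [k [E _]]. apply (res_not_adjacent k j E).
Qed.

(** This makes the collapsed coordinate [x - beta * count_below x] strictly larger at [y] than at
    the orbit point. *)
Lemma count_below_lt (j : nat) (y : R) :
  res j < y -> beta * (INR (count_below y) - INR (count_below (res j))) < y - res j.
Proof.
  intros Hy. pose proof (res_packing j y Hy) as H. revert H.
  set (l := length _). intros H.
  assert (E : (count_below (res j) + l = count_below y)%nat).
  { apply filter_length_plus. intros n _.
    destruct (ltb_spec (res j) (res n)), (ltb_spec y (res n)); simpl; trivial; lra. }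
  rewrite <- E, plus_INR. lra.
Qed.

Definition d_low : nat := length (filter (fun n => ltb (res n) c0) (seq 1 D)).

Lemma count_below_0 : count_below 0 = 0%nat.
Proof.
  unfold count_below.
  replace (filter (fun n => negb (ltb 0 (res n))) (seq 1 D)) with (@nil nat); trivial.
  symmetry. rewrite (filter_ext_in _ (fun _ => false)).
  - induction (seq 1 D); simpl; trivial.
  - intros n Hn. apply in_seq in Hn. destruct (ltb_spec 0 (res n)) as [|C]; trivial.
    exfalso. pose proof (res_bounds n). assert (n = 0%nat); [|lia].
    apply res_inj. rewrite res_0. lra.
Qed.

(** The extra unit is the index [D], whose residue is [c0] itself. *)
Lemma count_below_c0 : count_below c0 = S d_low.
Proof.
  unfold count_below, d_low.
  assert (ED : seq 1 D = seq 1 (pred D) ++ D :: nil).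
  { replace D with (S (pred D)) at 1 by lia. rewrite seq_S. repeat f_equal. lia. }
  rewrite ED, !filter_app, !length_app.
  rewrite (filter_ext_in (fun n => negb (ltb c0 (res n))) (fun n => ltb (res n) c0)).
  - simpl. rewrite res_D. destruct (ltb_spec c0 c0); [lra|]. simpl. lia.
  - intros n Hn. apply in_seq in Hn.
    destruct (ltb_spec c0 (res n)), (ltb_spec (res n) c0); simpl; trivial; try lra.
    exfalso. assert (n = D); [|lia]. apply res_inj. rewrite res_D. lra.
Qed.

Lemma count_below_a : count_below a = D.
Proof.
  unfold count_below. rewrite (filter_ext_in _ (fun _ => true)).
  - rewrite <- (length_seq D 1) at 2. f_equal. induction (seq 1 D); simpl; congruence.
  - intros n _. pose proof (res_bounds n). destruct (ltb_spec a (res n)); trivial; lra.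
Qed.

(** [visits] covers times 0 to [D - 1], [d_low] times 1 to [D]. Time 0 counts and time [D] does not,
    whence the extra 1. *)
Lemma visits_D : visits D 0 = (Z.of_nat d_low + 1)%Z.
Proof.
  assert (E : forall n, visits n 0 = zsum (fun i => bit (orbit (pred i) 0)) n).
  { induction n as [|n IH]; simpl; trivial. rewrite IH. trivial. }
  rewrite E, (zsum_pred (fun i => bit (orbit i 0))).
  rewrite (zsum_ext _ (fun i => if ltb (res i) c0 then 1%Z else 0%Z)) by
    (intros; apply bit_orbit).
  rewrite zsum_bool, !bit_orbit, res_0, res_D. unfold d_low.
  destruct (ltb_spec 0 c0), (ltb_spec c0 c0); try lra. lia.
Qed.

(* Collapsing the D gaps turns F into the rotation by c1 - m beta on a circle of
   length a - D beta. *)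
Definition collapse (x : R) : R :=
  x - beta * IZR (zsum (fun i => fl a (x - orbit i 0)) D).

(** By [fl_F_diff], applying [F] shifts the index of the sum by one. The boundary terms contribute
    [bit x + m]: the bit cancels the jump of [F], and [- m beta] remains. *)
Lemma collapse_F (x : R) : X x -> collapse (F x) = collapse x + (c1 - IZR m * beta).
Proof.
  intros Hx. assert (Ha : 0 < a) by lra. unfold collapse.
  rewrite (zsum_ext _ (fun i => fl a (x - orbit (pred i) 0))).
  - rewrite (zsum_pred (fun i => fl a (x - orbit i 0))), orbit_D. simpl orbit.
    replace (x - (c0 + IZR m * a)) with (x - c0 + IZR (- m) * a) by (rewrite opp_IZR; ring).
    rewrite fl_shift, Rminus_0_r by trivial. unfold F, bit.
    rewrite !minus_IZR, !plus_IZR, opp_IZR. ring.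
  - intros i Hi. destruct i as [|i]; [lia|]. simpl pred.
    change (orbit (S i) 0) with (F (orbit i 0)).
    apply fl_F_diff; trivial. apply X_orbit, zero_in_X.
Qed.

(** Splits [n] rotation steps into whole turns of length [a - D beta] and a collapsed residue: each
    floor in [collapse] depends on the two cells and on whether [res i <= res n]. *)
Lemma collapse_orbit (n : nat) :
  INR n * (c1 - IZR m * beta) =
  IZR (fl a (orbit n 0)) * (a - INR D * beta) + res n - beta * INR (count_below (res n)).
Proof.
  assert (Ha : 0 < a) by lra.
  assert (E : collapse (orbit n 0) = collapse 0 + INR n * (c1 - IZR m * beta)).
  { induction n as [|n IH]; [simpl; ring|]. rewrite S_INR.
    change (orbit (S n) 0) with (F (orbit n 0)).
    rewrite collapse_F, IH by apply X_orbit, zero_in_X. ring. }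
  assert (S : zsum (fun i => fl a (orbit n 0 - orbit i 0)) D =
     (zsum (fun i => fl a (0 - orbit i 0)) D + (Z.of_nat D * fl a (orbit n 0)
       + Z.of_nat (count_below (res n))))%Z).
  { unfold count_below. rewrite <- zsum_bool, <- zsum_const, <- !zsum_plus.
    apply zsum_ext. intros i Hi.
    (* For [i >= 1] the residue is non-zero, so negation costs one more unit in the floor. *)
    assert (H0 : fl a (0 - orbit i 0) = (- fl a (orbit i 0) - 1)%Z).
    { apply fl_unique; trivial. rewrite minus_IZR, opp_IZR.
      assert (res i <> 0). { intros H. rewrite <- res_0 in H. apply res_inj in H. lia. }
      pose proof (res_bounds i) as B. unfold res in *. rewrite opp_IZR in *. lra. }
    rewrite H0. apply fl_unique; trivial.
    pose proof (res_bounds i) as Bi. pose proof (res_bounds n) as Bn.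
    destruct (ltb_spec (res n) (res i)) as [H|H]; simpl negb; cbv iota;
      rewrite !plus_IZR, minus_IZR, opp_IZR; unfold res in *; rewrite !opp_IZR in *; lra. }
  unfold collapse in E. rewrite S, !plus_IZR, mult_IZR, <- !INR_IZR_INZ in E.
  unfold res at 1. rewrite opp_IZR. lra.
Qed.

(** Collapsing sends residues below [c0] into [[0, c0 - (d_low + 1) beta)] and the others into the
    rest of [[0, a - D beta)]; the hits are thus the [n] with [res n < c0]. *)
Lemma card_rotation_hits :
  Zcard (fun n => (1 <= n <= Z.of_nat D)%Z /\
     in_Ico_mod 0 (c0 - INR (S d_low) * beta) (a - INR D * beta)
       (IZR n * (c1 - IZR m * beta))) d_low.
Proof.
  assert (Ha : 0 < a) by lra.
  exists (map Z.of_nat (filter (fun n => ltb (res n) c0) (seq 1 D))).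
  split; [|split].
  - apply NoDup_map_NoDup_ForallPairs; [intros i k _ _; lia|].
    apply NoDup_filter, seq_NoDup.
  - assert (Hlow : forall n, res n < c0 ->
      0 <= res n - beta * INR (count_below (res n)) < c0 - INR (S d_low) * beta).
    { intros n Hn. split.
      - destruct (Req_dec (res n) 0) as [E|E].
        + rewrite E, count_below_0. simpl. lra.
        + pose proof (res_bounds n) as B.
          pose proof (count_below_lt 0 (res n)) as C.
          rewrite res_0, count_below_0 in C. simpl INR in C. lra.
      - pose proof (count_below_lt n c0 Hn) as C. rewrite count_below_c0 in C. lra. }
    assert (Hhigh : forall n, c0 <= res n ->
      c0 - INR (S d_low) * beta <= res n - beta * INR (count_below (res n)) < a - INR D * beta).
    { intros n Hn. split.
      - destruct (Req_dec (res n) c0) as [E|E].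
        + rewrite E, count_below_c0. lra.
        + pose proof (count_below_lt D (res n)) as C.
          rewrite res_D, count_below_c0 in C. lra.
      - pose proof (res_bounds n) as B.
        pose proof (count_below_lt n a) as C. rewrite count_below_a in C. lra. }
    assert (HY : 0 < c0 - INR (S d_low) * beta).
    { pose proof (Hlow 0%nat) as H. rewrite res_0 in H. lra. }
    assert (HL : c0 - INR (S d_low) * beta < a - INR D * beta).
    { pose proof (Hhigh D) as H. rewrite res_D in H. lra. }
    intros z. rewrite in_map_iff. split.
    + intros [n [<- Hn]]. apply filter_In in Hn. destruct Hn as [H1 H2].
      apply in_seq in H1. destruct (ltb_spec (res n) c0); [|discriminate].
      split; [lia|]. exists (fl a (orbit n 0)).
      rewrite <- INR_IZR_INZ, collapse_orbit.
      specialize (Hlow n r). lra.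
    + intros [H1 [k Hk]]. exists (Z.to_nat z). split; [lia|].
      apply filter_In. split; [apply in_seq; lia|].
      destruct (ltb_spec (res (Z.to_nat z)) c0) as [|C]; trivial. exfalso.
      assert (Hz : IZR z = INR (Z.to_nat z)) by (rewrite INR_IZR_INZ, Z2Nat.id by lia; trivial).
      rewrite Hz, collapse_orbit in Hk.
      assert (H := Hhigh _ ltac:(apply Rnot_lt_le; exact C)).
      set (L := a - INR D * beta) in *. set (v := res _ - _) in *.
      assert (E : fl L (v + IZR (fl a (orbit (Z.to_nat z) 0) - k) * L) = 0%Z).
      { apply fl_unique; [lra|]. rewrite minus_IZR. simpl. unfold v. lra. }
      rewrite fl_shift, (fl_unique L v 0) in E by (simpl; lra).
      assert (k = fl a (orbit (Z.to_nat z) 0)) by lia. subst k. unfold v in *. lra.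
  - rewrite length_map. reflexivity.
Qed.

End Counting.

(** Here [d1 = d_low D] and [d2 = D - d1 - 1]. The equation is the displacement of 0 in [D] steps;
    the inequalities are the strict packings in [(0, c0]] and [(c0, a]]. *)
Lemma invariant_set_parameters :
  (forall i j z, orbit i 0 <> orbit j 0 + beta + IZR z * a) ->
  exists (d1 d2 : nat) (m : Z),
    INR (d1 + d2 + 1) * c1 + INR (d1 + 1) * beta = c0 + IZR m * a /\
    INR (d1 + 1) * beta < c0 /\ c0 + INR d2 * beta < a /\
    Zcard (fun n => (1 <= n <= Z.of_nat (d1 + d2 + 1))%Z /\
      in_Ico_mod 0 (c0 - INR (d1 + 1) * beta) (a - INR (d1 + d2 + 1) * beta)
       (IZR n * (c1 - IZR m * beta))) d1.
Proof.
  intros Hadj. destruct orbit_zero_reaches_c0 as [D [m [HD [HDm Hgap]]]].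
  pose proof (count_below_c0 D m HD HDm) as Cc.
  pose proof (count_below_a D) as Ca.
  set (d1 := d_low D) in *.
  assert (Hle : (S d1 <= D)%nat).
  { rewrite <- Cc. unfold count_below. rewrite <- (length_seq D 1) at 2.
    apply filter_length_le. }
  exists d1, (D - S d1)%nat, m.
  replace (d1 + (D - S d1) + 1)%nat with D by lia.
  replace (d1 + 1)%nat with (S d1) by lia.
  split; [|split; [|split]].
  - pose proof (orbit_formula D 0) as E. rewrite HDm, (visits_D D m HD HDm) in E.
    rewrite plus_IZR, <- INR_IZR_INZ in E. fold d1 in E. rewrite S_INR. lra.
  - pose proof (count_below_lt D HD Hgap Hadj 0 c0) as H.
    rewrite Cc, res_0, (count_below_0 D HD) in H. simpl (INR 0) in H.
    lra.
  - pose proof (count_below_lt D HD Hgap Hadj D a) as H.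
    rewrite (res_D D m HDm), Ca, Cc in H. rewrite minus_INR by trivial. lra.
  - apply card_rotation_hits; trivial.
Qed.

End InvariantSet.

(** * Translation invariance and right closures *)

Lemma off_hole_shift (x : R) (z : Z) : off_hole x -> off_hole (x + IZR z * a).
Proof.
  unfold off_hole. rewrite fl_shift, plus_IZR by lra. lra.
Qed.

(** Adding limits makes least elements exist; limits from the right are compatible with [F], whose
    floors are right-continuous. *)
Definition right_closure (Y : R -> Prop) (v : R) : Prop :=
  forall e, 0 < e -> exists x, Y x /\ v <= x < v + e.

Section RightClosure.

Variable Y : R -> Prop.
Hypothesis Y_nonempty : exists x, Y x.
Hypothesis Y_shift : forall x z, Y x -> Y (x + IZR z * a).
Hypothesis Y_off_hole : forall x, Y x -> off_hole x.
Hypothesis Y_fwd : forall x, Y x -> Y (F x).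
Hypothesis Y_bwd : forall x, Y x -> exists y, Y y /\ F y = x.

Lemma right_closure_shift (v : R) (z : Z) :
  right_closure Y v -> right_closure Y (v + IZR z * a).
Proof.
  intros H e He. destruct (H e He) as [x [Hx Hb]].
  exists (x + IZR z * a). split; [auto|lra].
Qed.

Lemma right_closure_off_hole (v : R) : right_closure Y v -> off_hole v.
Proof.
  intros H. assert (Ha : 0 < a) by lra. unfold off_hole.
  destruct (Rlt_le_dec v (IZR (fl a v) * a + c0)) as [H1|H1]; [left|right; trivial].
  destruct (Rlt_le_dec v (IZR (fl a v) * a + c0 - beta)) as [H2|H2]; trivial. exfalso.
  destruct (H (IZR (fl a v) * a + c0 - v)) as [x [Hx Hb]]; [lra|].
  assert (E : fl a x = fl a v).
  { apply fl_unique; trivial. pose proof (fl_spec a v Ha). lra. }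
  destruct (Y_off_hole x Hx) as [C|C]; rewrite E in C; lra.
Qed.

Lemma right_closure_fwd (v : R) : right_closure Y v -> right_closure Y (F v).
Proof.
  intros H e He. destruct (bit_right_constant v) as [e' [He' Hc]].
  destruct (H (Rmin e e')) as [x [Hx Hb]]; [apply Rmin_glb_lt; trivial|].
  pose proof (Rmin_l e e'). pose proof (Rmin_r e e').
  exists (F x). split; [auto|]. unfold F. rewrite (Hc x) by lra. lra.
Qed.

(** One bit value [i] occurs for preimages of points arbitrarily close to [v] on the right. Undoing
    that branch gives [y], and right continuity gives [bit y = i]. *)
Lemma right_closure_bwd (v : R) :
  right_closure Y v -> exists y, right_closure Y y /\ F y = v.
Proof.
  intros H.
  assert (Hi : exists i, forall e, 0 < e -> exists y, Y y /\ bit y = i /\ v <= F y < v + e).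
  { apply NNPP. intros Hno.
    assert (Hn : forall i, exists e, 0 < e /\ forall y, Y y -> bit y = i -> ~ v <= F y < v + e).
    { intros i. apply NNPP. intros Hc. apply Hno. exists i. intros e He.
      apply NNPP. intros Hd. apply Hc. exists e. split; trivial.
      intros y Hy Hb Hv. apply Hd. exists y. auto. }
    destruct (Hn 0%Z) as [e0 [He0 H0]]. destruct (Hn 1%Z) as [e1 [He1 H1]].
    destruct (H (Rmin e0 e1)) as [x [Hx Hb]]; [apply Rmin_glb_lt; trivial|].
    pose proof (Rmin_l e0 e1). pose proof (Rmin_r e0 e1).
    destruct (Y_bwd x Hx) as [y [Hy <-]].
    destruct (bit_cases y) as [[B _]|[B _]]; [apply (H1 y)|apply (H0 y)]; trivial; lra. }
  destruct Hi as [i Hi].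
  set (y := v - c1 - beta * IZR i).
  exists y. split.
  - intros e He. destruct (Hi e He) as [x [Hx [Hb Hv]]]. exists x. split; trivial.
    unfold F in Hv. rewrite Hb in Hv. unfold y. lra.
  - destruct (bit_right_constant y) as [e [He Hc]].
    destruct (Hi e He) as [x [Hx [Hb Hv]]].
    unfold F in Hv. rewrite Hb in Hv.
    unfold F. rewrite <- (Hc x), Hb by (unfold y; lra). unfold y. ring.
Qed.

Lemma right_closure_min (r : R) :
  exists v, right_closure Y v /\ r <= v /\
    forall x, right_closure Y x -> r <= x -> v <= x.
Proof.
  assert (Ha : 0 < a) by lra.
  destruct (completeness (fun x => right_closure Y (- x) /\ r <= - x)) as [g [Hub Hlub]].
  - exists (- r). intros x [_ Hx]. lra.
  - destruct Y_nonempty as [x Hx].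
    exists (- (x + IZR (1 - fl a (x - r)) * a)). rewrite Ropp_involutive. split.
    + intros e He. exists (x + IZR (1 - fl a (x - r)) * a). split; [auto|lra].
    + rewrite minus_IZR. pose proof (fl_spec a (x - r) Ha). lra.
  - exists (- g). split; [|split].
    + intros e He. apply NNPP. intros Hno.
      assert (g <= g - e); [|lra].
      apply Hlub. intros x [Hx Hr].
      assert (Hxg : x <= g) by (apply Hub; split; trivial).
      destruct (Rle_dec x (g - e)) as [|C]; trivial. exfalso.
      destruct (Hx (x - (g - e))) as [y [Hy Hb]]; [lra|].
      apply Hno. exists y. split; [trivial|lra].
    + assert (g <= - r); [|lra]. apply Hlub. intros x [_ Hx]. lra.
    + intros x Hx Hr. assert (- x <= g); [|lra].
      apply Hub. rewrite Ropp_involutive. split; trivial.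
Qed.

End RightClosure.
End CircleMap.

(** * Rows of the matrix as windows on the line *)

Section Windows.

Variables a b c0 : R.
Variables N M : Z.
Hypothesis a_pos : 0 < a.
Hypothesis a_lt_b : a < b.
Hypothesis c0_bounds : b - a < c0 < a.
Hypothesis N_ge_2 : (2 <= N)%Z.

Let c : R := IZR N * b + c0.
Let c1 : R := IZR N * b - IZR M * a.
Let T : R -> R := F a (b - a) c0 c1.

(** * Necessity: the support of a solution *)

Section Necessity.

Hypothesis incommensurable : forall p q : Z, IZR p * a = IZR q * b -> q = 0%Z.

(** Displacements are integer combinations of [a] and [b], so the coefficients of [b] must agree;
    each step contributes [N] plus its bit. *)
Lemma orbit_difference (x : R) (i j : nat) (e z : Z) :
  orbit a (b - a) c0 c1 i x = orbit a (b - a) c0 c1 j x + IZR e * (b - a) + IZR z * a ->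
  ((Z.of_nat i - Z.of_nat j) * N + visits a (b - a) c0 c1 i x
     - visits a (b - a) c0 c1 j x = e)%Z.
Proof.
  rewrite !orbit_formula.
  set (vi := visits _ _ _ _ i x). set (vj := visits _ _ _ _ j x). intros H.
  rewrite !INR_IZR_INZ in H. unfold c1 in H.
  assert (E : ((Z.of_nat i - Z.of_nat j) * N + vi - vj - e = 0)%Z); [|lia].
  apply (incommensurable (z + (Z.of_nat i - Z.of_nat j) * M + vi - vj - e)).
  rewrite ?minus_IZR, ?plus_IZR, ?minus_IZR, ?mult_IZR, ?plus_IZR, ?minus_IZR, ?mult_IZR, ?minus_IZR.
  lra.
Qed.

Lemma orbit_aperiodic (x : R) (i j : nat) (z : Z) :
  orbit a (b - a) c0 c1 i x = orbit a (b - a) c0 c1 j x + IZR z * a -> i = j.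
Proof.
  intros H. assert (E := orbit_difference x i j 0 z).
  rewrite Rmult_0_l, Rplus_0_r in E. specialize (E H).
  destruct (Nat.lt_total i j) as [L|[L|L]]; trivial; exfalso.
  - pose proof (visits_mono a (b - a) c0 c1 ltac:(lra) ltac:(lra) x i j ltac:(lia)). nia.
  - pose proof (visits_mono a (b - a) c0 c1 ltac:(lra) ltac:(lra) x j i ltac:(lia)). nia.
Qed.

(* One step of the orbit moves by at least N >= 2 multiples of b modulo a. *)
Lemma orbit_not_shifted (x : R) (i j : nat) (z : Z) :
  orbit a (b - a) c0 c1 i x <> orbit a (b - a) c0 c1 j x + (b - a) + IZR z * a.
Proof.
  intros H. assert (E := orbit_difference x i j 1 z).
  rewrite Rmult_1_l in E. specialize (E H).
  destruct (Nat.lt_total i j) as [L|[L|L]].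
  - pose proof (visits_mono a (b - a) c0 c1 ltac:(lra) ltac:(lra) x i j ltac:(lia)). nia.
  - subst j. nia.
  - pose proof (visits_mono a (b - a) c0 c1 ltac:(lra) ltac:(lra) x j i ltac:(lia)). nia.
Qed.

(** Let [s] be the offset of [p] in its cell, so [s + n b] lies in [[c, c + a)]. For [n = N] this
    means [s >= c0], for [n = N + 1] it means [s < c0 - (b - a)], and no other [n] fits. *)
Lemma window_step (p : R) (n : Z) :
  IZR (fl a p) * a + c <= p + IZR n * b < IZR (fl a p) * a + a + c ->
  off_hole a (b - a) c0 p /\
  p + IZR n * b = T p + IZR (M + bit a c0 p) * a.
Proof.
  intros H. pose proof (fl_spec a p a_pos) as Hp. unfold c in H.
  assert (Hn : n = N \/ n = (N + 1)%Z).
  { assert (N <= n)%Z.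
    { destruct (Z_le_gt_dec N n) as [|G]; trivial. exfalso.
      assert (IZR n + 1 <= IZR N) by (rewrite <- plus_IZR; apply IZR_le; lia). nra. }
    assert (n <= N + 1)%Z; [|lia].
    destruct (Z_le_gt_dec n (N + 1)) as [|G]; trivial. exfalso.
    assert (IZR N + 2 <= IZR n) by (rewrite <- plus_IZR; apply IZR_le; lia). nra. }
  unfold T, F, off_hole, c1.
  destruct (bit_cases a (b - a) c0 ltac:(lra) ltac:(lra) p) as [[-> B]|[-> B]];
    destruct Hn; subst n; rewrite ?plus_IZR in *; split; try lra.
Qed.

Lemma S_nonempty_parameters :
  S_nonempty a b c ->
  exists (d1 d2 : nat) (m : Z),
    INR (d1 + d2 + 1) * c1 + INR (d1 + 1) * (b - a) = c0 + IZR m * a /\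
    INR (d1 + 1) * (b - a) < c0 /\ c0 + INR d2 * (b - a) < a /\
    Zcard (fun n => (1 <= n <= Z.of_nat (d1 + d2 + 1))%Z /\
      in_Ico_mod 0 (c0 - INR (d1 + 1) * (b - a)) (a - INR (d1 + d2 + 1) * (b - a))
       (IZR n * (c1 - IZR m * (b - a)))) d1.
Proof.
  intros [t [x [Hx0 Hx]]].
  assert (Hc : a < c).
  { unfold c. assert (2 <= IZR N) by (apply IZR_le; trivial). nra. }
  set (Y := fun v => exists k l, x k = true /\ v = t + b * IZR k + IZR l * a).
  (* Row [j] is the last one whose window contains the point of [k]. The point in row [j + 1] cannot
     also be in row [j], so it lies at or beyond [a j + c]. *)
  assert (Hnext : forall k, x k = true -> exists k', x k' = true /\
     IZR (fl a (t + b * IZR k)) * a + c <= (t + b * IZR k) + IZR (k' - k) * b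
       < IZR (fl a (t + b * IZR k)) * a + a + c).
  { intros k Hk. set (j := fl a (t + b * IZR k)).
    pose proof (fl_spec a (t + b * IZR k) a_pos) as Hp. fold j in Hp.
    destruct (Hx (j + 1)%Z) as [k' [[Hk' Hw] _]]. exists k'. split; trivial.
    rewrite minus_IZR. unfold in_Ico0 in Hw. rewrite plus_IZR in Hw.
    split; [|lra]. apply Rnot_lt_le. intros Hlt.
    destruct (Hx j) as [k0 [_ Hu]].
    assert (k0 = k) by (apply Hu; split; trivial; unfold in_Ico0; lra).
    assert (k0 = k') by (apply Hu; split; trivial; unfold in_Ico0; lra).
    subst k0 k'. lra. }
  (* Symmetrically, row [j + 1] is the first to contain the point of [k], and the point in row [j]
     must lie before [a (j + 1)]. *)
  assert (Hprev : forall k, x k = true -> exists k', x k' = true /\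
     IZR (fl a (t + b * IZR k')) * a + c <= (t + b * IZR k') + IZR (k - k') * b
       < IZR (fl a (t + b * IZR k')) * a + a + c).
  { intros k Hk. set (j := fl a (t + b * IZR k - c)).
    pose proof (fl_spec a (t + b * IZR k - c) a_pos) as Hp. fold j in Hp.
    destruct (Hx j) as [k' [[Hk' Hw] _]]. exists k'. split; trivial.
    unfold in_Ico0 in Hw.
    assert (E : fl a (t + b * IZR k') = j).
    { apply fl_unique; trivial. split; [lra|]. apply Rnot_le_lt. intros Hge.
      destruct (Hx (j + 1)%Z) as [k0 [_ Hu]].
      assert (k0 = k) by (apply Hu; split; trivial; unfold in_Ico0; rewrite plus_IZR; lra).
      assert (k0 = k') by (apply Hu; split; trivial; unfold in_Ico0; rewrite plus_IZR; lra).
      subst k0 k'. lra. }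
    rewrite E, minus_IZR. lra. }
  assert (Y_nonempty : exists v, Y v) by (exists (t + b * IZR 0 + IZR 0 * a), 0%Z, 0%Z; auto).
  assert (Y_shift : forall v z, Y v -> Y (v + IZR z * a)).
  { intros v z [k [l [Hk ->]]]. exists k, (l + z)%Z. rewrite plus_IZR. split; [trivial|ring]. }
  assert (Y_off_hole : forall v, Y v -> off_hole a (b - a) c0 v).
  { intros v [k [l [Hk ->]]]. destruct (Hnext k Hk) as [k' [Hk' Hw]].
    apply off_hole_shift; try lra. apply (window_step _ _ Hw). }
  assert (Y_fwd : forall v, Y v -> Y (T v)).
  { intros v [k [l [Hk ->]]]. destruct (Hnext k Hk) as [k' [Hk' Hw]].
    destruct (window_step _ _ Hw) as [_ E].
    exists k', (l - (M + bit a c0 (t + b * IZR k)))%Z. split; trivial.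
    unfold T in *. rewrite F_shift by lra. rewrite minus_IZR in *. lra. }
  assert (Y_bwd : forall v, Y v -> exists y, Y y /\ T y = v).
  { intros v [k [l [Hk ->]]]. destruct (Hprev k Hk) as [k' [Hk' Hw]].
    destruct (window_step _ _ Hw) as [_ E].
    exists (t + b * IZR k' + IZR (l + (M + bit a c0 (t + b * IZR k'))) * a).
    split; [exists k', (l + (M + bit a c0 (t + b * IZR k')))%Z; auto|].
    unfold T in *. rewrite F_shift by lra. rewrite (plus_IZR l). rewrite minus_IZR in E. lra. }
  assert (Hb : 0 < b - a) by lra.
  apply (invariant_set_parameters a (b - a) c0 c1 Hb c0_bounds (right_closure Y)).
  - intros; apply right_closure_shift; trivial.
  - intros; apply right_closure_off_hole with (Y := Y); trivial.
  - intros; apply right_closure_fwd; trivial.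
  - intros; apply right_closure_bwd; trivial.
  - intros; apply right_closure_min with (a := a) (beta := b - a) (c0 := c0); trivial.
  - intros v i j z _. apply orbit_aperiodic.
  - intros i j z. apply orbit_not_shifted.
Qed.

End Necessity.

(** * Sufficiency: a solution from a two-sided sequence of steps *)

Lemma partition_by_increasing (w : Z -> Z) :
  (forall i, (w (i - 1) < w i)%Z) ->
  forall j, exists i, (w (i - 1) < j <= w i)%Z /\
    forall i', (w (i' - 1) < j <= w i')%Z -> i' = i.
Proof.
  intros Hw j.
  assert (Hgrow : forall n i, (w i + Z.of_nat n <= w (i + Z.of_nat n))%Z).
  { induction n as [|n IH]; intros i; [simpl; rewrite !Z.add_0_r; lia|].
    specialize (IH i). pose proof (Hw (i + Z.of_nat (S n))%Z) as H.
    replace (i + Z.of_nat (S n) - 1)%Z with (i + Z.of_nat n)%Z in H by lia. lia. }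
  assert (Hmono : forall i i', (i <= i')%Z -> (w i <= w i')%Z).
  { intros i i' H. specialize (Hgrow (Z.to_nat (i' - i)) i).
    replace (i + Z.of_nat (Z.to_nat (i' - i)))%Z with i' in Hgrow by lia. lia. }
  assert (Hex : forall n i, (j <= w i <= j + Z.of_nat n)%Z -> exists i', (w (i' - 1) < j <= w i')%Z).
  { induction n as [|n IH]; intros i Hi.
    - exists i. specialize (Hw i). lia.
    - destruct (Z_lt_le_dec (w (i - 1)%Z) j) as [H|H]; [exists i; lia|].
      apply (IH (i - 1)%Z). specialize (Hw i). lia. }
  (* Growth by at least 1 per index puts [w i0] at or above [j]; descending from [i0] then finds the
     interval. *)
  set (i0 := Z.of_nat (Z.to_nat (j - w 0%Z))).
  assert (Hi0 : (j <= w i0)%Z).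
  { specialize (Hgrow (Z.to_nat (j - w 0%Z)) 0%Z). rewrite Z.add_0_l in Hgrow. fold i0 in Hgrow. lia. }
  destruct (Hex (Z.to_nat (w i0 - j)) i0) as [i Hi]; [lia|].
  exists i. split; trivial. intros i' Hi'.
  destruct (Z.lt_total i i') as [H|[H|H]]; [|lia|].
  - pose proof (Hmono i (i' - 1)%Z). lia.
  - pose proof (Hmono i' (i - 1)%Z). lia.
Qed.

(** The step rule keeps the next point minus [c] in the cell of the current one. So the [i]-th point
    lies in exactly the rows [(w (i - 1), w i]], and these partition the integers. *)
Lemma S_nonempty_of_steps (t : R) (k : Z -> Z) :
  k 0%Z = 0%Z ->
  (forall i, off_hole a (b - a) c0 (t + b * IZR (k i))) ->
  (forall i, k (i + 1)%Z = (k i + N + bit a c0 (t + b * IZR (k i)))%Z) ->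
  S_nonempty a b c.
Proof.
  intros Hk0 Hoff Hstep.
  assert (Hc : a < c).
  { unfold c. assert (2 <= IZR N) by (apply IZR_le; trivial). nra. }
  set (w := fun i => fl a (t + b * IZR (k i))).
  assert (Hend : forall i, fl a (t + b * IZR (k (i + 1)%Z) - c) = w i).
  { intros i. apply fl_unique; trivial. rewrite Hstep.
    specialize (Hoff i). unfold w, off_hole in *. set (p := t + b * IZR (k i)) in *.
    pose proof (fl_spec a p a_pos) as Sp.
    replace (t + b * IZR (k i + N + bit a c0 p) - c)
      with (p + IZR (bit a c0 p) * b - c0) by (unfold c, p at 1; rewrite !plus_IZR; ring).
    destruct (bit_cases a (b - a) c0 ltac:(lra) ltac:(lra) p) as [[-> B]|[-> B]]; lra. }
  assert (Hin : forall i j, in_Ico0 c (t - a * IZR j + b * IZR (k i)) <-> (w (i - 1) < j <= w i)%Z).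
  { intros i j. specialize (Hend (i - 1)%Z). replace (i - 1 + 1)%Z with i in Hend by lia.
    rewrite <- Hend. unfold w, in_Ico0. set (p := t + b * IZR (k i)).
    pose proof (fl_spec a p a_pos) as Sp. pose proof (fl_spec a (p - c) a_pos) as Sq.
    replace (t - a * IZR j + b * IZR (k i)) with (p - a * IZR j) by (unfold p; ring).
    split.
    - intros [H1 H2]. split.
      + apply Z.nle_gt. intros H. apply IZR_le in H. nra.
      + apply Z.nlt_ge. intros H.
        assert (IZR (fl a p) + 1 <= IZR j) by (rewrite <- plus_IZR; apply IZR_le; lia). nra.
    - intros [H1 H2]. apply IZR_le in H2.
      assert (IZR (fl a (p - c)) + 1 <= IZR j) by (rewrite <- plus_IZR; apply IZR_le; lia).
      split; nra. }
  assert (Hw : forall i, (w (i - 1) < w i)%Z).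
  { intros i. apply (proj1 (Hin i (w i))). unfold in_Ico0, w.
    pose proof (fl_spec a (t + b * IZR (k i)) a_pos). lra. }
  (* The vector is the indicator of the range of [k]. *)
  exists t, (fun z => if excluded_middle_informative (exists i, z = k i) then true else false).
  split.
  - destruct (excluded_middle_informative _) as [|n]; trivial.
    exfalso. apply n. exists 0%Z. congruence.
  - intros j. destruct (partition_by_increasing w Hw j) as [i [Hi Hu]].
    exists (k i). split.
    + split; [|apply Hin; trivial].
      destruct (excluded_middle_informative _) as [|n]; trivial.
      exfalso. apply n. exists i. trivial.
    + intros z [Hz Hwz].
      destruct (excluded_middle_informative _) as [[i' ->]|]; [|discriminate].
      apply Hin, Hu in Hwz. congruence.
Qed.

(** * Sufficiency: re-inserting gaps into a rotation *)

Section Rotation.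

Variables (d1 D : nat) (m : Z).
Let L : R := a - INR D * (b - a).
Let Y : R := c0 - INR (d1 + 1) * (b - a).
Let theta : R := c1 - IZR m * (b - a).
Hypothesis D_pos : (1 <= D)%nat.
Hypothesis Y_pos : 0 < Y.
Hypothesis Y_lt_L : Y < L.
Hypothesis D_theta : INR D * theta = Y + IZR m * L.
Hypothesis card_hits :
  Zcard (fun n => (1 <= n <= Z.of_nat D)%Z /\ in_Ico_mod 0 Y L (IZR n * theta)) d1.

Definition rot (n : nat) : R := INR n * theta - IZR (fl L (INR n * theta)) * L.

Lemma rot_bounds (n : nat) : 0 <= rot n < L.
Proof. unfold rot. pose proof (fl_spec L (INR n * theta) ltac:(lra)). lra. Qed.

Lemma hit_iff (n : nat) : in_Ico_mod 0 Y L (IZR (Z.of_nat n) * theta) <-> rot n < Y.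
Proof.
  rewrite <- INR_IZR_INZ. split.
  - intros [k Hk]. assert (E : fl L (INR n * theta) = k) by (apply fl_unique; lra).
    unfold rot. rewrite E. lra.
  - intros H. exists (fl L (INR n * theta)). pose proof (rot_bounds n). unfold rot in *. lra.
Qed.

Definition rot_count (y : R) : nat :=
  length (filter (fun n => negb (ltb y (rot n))) (seq 1 D)).

Lemma rot_count_low (y : R) : y < Y -> (rot_count y <= d1)%nat.
Proof.
  intros Hy. destruct card_hits as [l [_ [Hl Hlen]]].
  unfold rot_count. rewrite <- Hlen. rewrite <- (length_map Z.of_nat). apply NoDup_incl_length.
  - apply NoDup_map_NoDup_ForallPairs; [intros i j _ _; lia|].
    apply NoDup_filter, seq_NoDup.
  - intros z Hz. apply in_map_iff in Hz. destruct Hz as [n [<- Hn]].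
    apply filter_In in Hn. destruct Hn as [H1 H2]. apply in_seq in H1.
    apply Hl. split; [lia|]. apply hit_iff.
    destruct (ltb_spec y (rot n)); [discriminate|lra].
Qed.

(** Besides the [d1] hits there is the index [D], since [rot D = Y] lies just outside [[0, Y)]. *)
Lemma rot_count_high (y : R) : Y <= y -> (d1 + 1 <= rot_count y)%nat.
Proof.
  intros Hy. destruct card_hits as [l [Hnd [Hl Hlen]]].
  assert (ED : rot D = Y).
  { unfold rot. rewrite D_theta.
    rewrite fl_shift, (fl_unique L Y 0) by (simpl; lra). simpl. ring. }
  replace (d1 + 1)%nat with (length (Z.of_nat D :: l)) by (simpl; lia).
  unfold rot_count. rewrite <- (length_map Z.of_nat (filter _ _)). apply NoDup_incl_length.
  - constructor; trivial. intros HD. apply Hl in HD. destruct HD as [_ HD].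
    apply hit_iff in HD. lra.
  - intros z Hz. apply in_map_iff. exists (Z.to_nat z).
    assert (Hz' : (1 <= z <= Z.of_nat D)%Z /\ rot (Z.to_nat z) <= Y).
    { destruct Hz as [<-|Hz].
      - rewrite Nat2Z.id. split; [lia|lra].
      - apply Hl in Hz. destruct Hz as [H1 H2]. split; trivial. left. apply hit_iff.
        rewrite Z2Nat.id by lia. trivial. }
    destruct Hz' as [H1 H2]. split; [lia|]. apply filter_In. split; [apply in_seq; lia|].
    destruct (ltb_spec y (rot (Z.to_nat z))); trivial. lra.
Qed.

Lemma rot_count_le (y : R) : (rot_count y <= D)%nat.
Proof.
  unfold rot_count. rewrite <- (length_seq D 1) at 2. apply filter_length_le.
Qed.

(* [blow_up i] re-inserts the D gaps below the point i theta of the rotation orbit. *)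
Definition wraps (i : Z) : Z := zsum (fun n => fl L (IZR (i - Z.of_nat n) * theta)) D.
Definition wraps0 : Z := zsum (fun n => (1 + fl L (INR n * theta))%Z) D.
Definition blow_up (i : Z) : R := IZR i * theta + (b - a) * IZR (wraps i + wraps0).

(** Each floor in [wraps i] is [w - fl L (n theta)], less one if [rot n > y]; adding [wraps0] leaves
    [w], plus one exactly when [rot n <= y]. *)
Lemma blow_up_formula (i : Z) :
  let w := fl L (IZR i * theta) in
  let y := IZR i * theta - IZR w * L in
  blow_up i = IZR w * a + y + (b - a) * INR (rot_count y).
Proof.
  intros w y. assert (HL : 0 < L) by lra.
  assert (E : (wraps i + wraps0 = Z.of_nat D * w + Z.of_nat (rot_count y))%Z).
  { unfold wraps, wraps0, rot_count.
    rewrite <- zsum_bool, <- zsum_const, <- !zsum_plus. apply zsum_ext. intros n Hn.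
    assert (Hy : 0 <= y < L) by (unfold y, w; pose proof (fl_spec L (IZR i * theta) HL); lra).
    pose proof (rot_bounds n) as Hr.
    set (f := fl L (INR n * theta)) in *.
    rewrite (fl_unique L _ (w - f + (if negb (ltb y (rot n)) then 0 else -1))%Z); trivial.
    - destruct (ltb_spec y (rot n)); cbn [negb]; lia.
    - rewrite plus_IZR, !minus_IZR, <- INR_IZR_INZ.
      assert (Er : rot n = INR n * theta - IZR f * L) by reflexivity.
      destruct (ltb_spec y (rot n)) as [H|H]; simpl; unfold y in *; lra. }
  unfold blow_up. rewrite E, plus_IZR, mult_IZR, <- !INR_IZR_INZ. unfold y, L. ring.
Qed.

(** At most [d1] gaps are inserted when [y < Y], and at least [d1 + 1] when [y >= Y]. Since
    [Y = c0 - (d1 + 1) (b - a)], the point falls below the hole or at or beyond [c0],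
    respectively. *)
Lemma blow_up_spec (i : Z) :
  off_hole a (b - a) c0 (blow_up i) /\
  bit a c0 (blow_up i) = (fl L (IZR i * theta) - fl L (IZR i * theta - Y))%Z.
Proof.
  assert (HL : 0 < L) by lra.
  pose proof (blow_up_formula i) as E. cbv zeta in E.
  set (w := fl L (IZR i * theta)) in *. set (y := IZR i * theta - IZR w * L) in *.
  assert (Hy : 0 <= y < L) by (unfold y, w; pose proof (fl_spec L (IZR i * theta) HL); lra).
  pose proof (rot_count_le y) as Hle. apply le_INR in Hle. pose proof (pos_INR (rot_count y)) as Hp.
  assert (Efl : fl a (blow_up i) = w).
  { apply fl_unique; trivial. rewrite E. unfold L in Hy. nra. }
  destruct (Rlt_le_dec y Y) as [H|H].
  - pose proof (rot_count_low y H) as Hc. apply le_INR in Hc.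
    assert (Hb : blow_up i < IZR w * a + c0 - (b - a)).
    { rewrite E. unfold Y in H. rewrite plus_INR in H. simpl in H. nra. }
    split; [left; rewrite Efl; trivial|].
    rewrite (fl_unique L _ (w - 1)); trivial; [|rewrite minus_IZR; unfold y in *; lra].
    destruct (bit_cases a (b - a) c0 ltac:(lra) ltac:(lra) (blow_up i)) as [[-> B]|[_ B]];
      [lia|rewrite Efl in B; lra].
  - pose proof (rot_count_high y H) as Hc. apply le_INR in Hc.
    assert (Hb : IZR w * a + c0 <= blow_up i).
    { rewrite E. unfold Y in H. nra. }
    split; [right; rewrite Efl; trivial|].
    rewrite (fl_unique L _ w); trivial; [|unfold y in *; lra].
    destruct (bit_cases a (b - a) c0 ltac:(lra) ltac:(lra) (blow_up i)) as [[_ B]|[-> B]];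
      [rewrite Efl in B; lra|lia].
Qed.

(** The index shift gains [fl L (i theta)] and loses [fl L ((i - D) theta)]; by [D theta = Y + m L]
    the difference is [m] plus the bit. *)
Lemma wraps_succ (i : Z) : wraps (i + 1) = (wraps i + m + bit a c0 (blow_up i))%Z.
Proof.
  destruct (blow_up_spec i) as [_ ->]. unfold wraps.
  rewrite (zsum_ext _ (fun n => fl L (IZR (i - Z.of_nat (pred n)) * theta))).
  - rewrite (zsum_pred (fun n => fl L (IZR (i - Z.of_nat n) * theta))).
    simpl (Z.of_nat 0). rewrite Z.sub_0_r.
    replace (IZR (i - Z.of_nat D) * theta) with (IZR i * theta - Y + IZR (- m) * L).
    + rewrite fl_shift by lra. lia.
    + rewrite minus_IZR, opp_IZR, <- INR_IZR_INZ. lra.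
  - intros n Hn. do 3 f_equal. lia.
Qed.

Lemma S_nonempty_of_rotation : S_nonempty a b c.
Proof.
  (* [k i] is the coefficient of [b] in [blow_up i - blow_up 0], expanded in [a] and [b]. *)
  set (k := fun i => (N * i + wraps i - wraps 0 - m * i)%Z).
  assert (E : forall i, blow_up 0 + b * IZR (k i) =
                        blow_up i + IZR (wraps i - wraps 0 - m * i + M * i) * a).
  { intros i. unfold blow_up, k, theta, c1.
    rewrite ?minus_IZR, ?plus_IZR, ?minus_IZR, ?mult_IZR, ?plus_IZR, ?minus_IZR, ?mult_IZR. ring. }
  apply (S_nonempty_of_steps (blow_up 0) k).
  - unfold k. lia.
  - intros i. rewrite E. apply off_hole_shift; try lra. apply blow_up_spec.
  - intros i. rewrite E, bit_shift with (beta := b - a) by lra.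
    unfold k. rewrite wraps_succ. lia.
Qed.

End Rotation.
End Windows.

(** * The equivalence in the original parameters *)

Theorem theorem6p1 (a b c : R) :
  0 < a -> a < b -> b < c ->
  (2 <= rfloor (c / b))%Z ->
  b - a < c0_of a b c < a ->
  0 < c1_of a b c < 2 * a - b ->
  ~ rational (a / b) ->
  (S_nonempty a b c <->
   exists d1 d2 : nat,
     in_multZ a (c - INR (d1 + 1) * (IZR (rfloor (c / b)) + 1) * (b - a)
                   - INR (d2 + 1) * IZR (rfloor (c / b)) * (b - a)) /\
     IZR (rfloor (c / b)) * b + INR (d1 + 1) * (b - a) < c /\
     c < IZR (rfloor (c / b)) * b + b - INR (d2 + 1) * (b - a) /\
     Zcard (E_set a b c d1 d2) d1).
Proof.
  intros Ha Hab Hbc HN Hc0 _ Hirr.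
  assert (Hinc : forall p q : Z, IZR p * a = IZR q * b -> q = 0%Z).
  { intros p q E. destruct (Z.eq_dec q 0) as [|Hq]; trivial. exfalso.
    assert (Hp : p <> 0%Z).
    { intros ->. apply Hq, eq_IZR. apply (Rmult_eq_reg_r b); lra. }
    apply Hirr. exists q, p. split; trivial.
    apply not_0_IZR in Hp. apply (Rmult_eq_reg_r (IZR p * b)); [|nra].
    field_simplify; lra. }
  unfold E_set, m_of.
  set (N := rfloor (c / b)) in *. set (c0 := c0_of a b c) in *.
  set (M := rfloor ((c - c0) / a)).
  assert (Ec : c = IZR N * b + c0) by (unfold c0, c0_of; fold N; ring).
  assert (Ec1 : c1_of a b c = IZR N * b - IZR M * a).
  { unfold c1_of. fold c0. fold M. lra. }
  rewrite Ec1. split.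
  - intros HS. rewrite Ec in HS.
    destruct (S_nonempty_parameters a b c0 N M Ha Hab Hc0 HN Hinc HS)
      as [d1 [d2 [m [Hm [H1 [H2 HE]]]]]].
    exists d1, d2.
    assert (Em : (INR (d1 + d2 + 1) * (IZR N * b - IZR M * a) - c0 + INR (d1 + 1) * (b - a)) / a = IZR m).
    { apply (Rmult_eq_reg_r a); [|lra]. unfold Rdiv. rewrite Rmult_assoc, Rinv_l by lra. lra. }
    rewrite Em. split; [|split; [|split]]; trivial.
    + exists (Z.of_nat (d1 + d2 + 1) * (N - M) + N - m)%Z.
      rewrite minus_IZR, plus_IZR, mult_IZR, minus_IZR, <- INR_IZR_INZ.
      rewrite !plus_INR in *. simpl INR in *. rewrite Ec. lra.
    + lra.
    + rewrite plus_INR. simpl (INR 1). lra.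
  - intros [d1 [d2 [[k Hk] [H1 [H2 HE]]]]].
    (* The same relation between [k] and [m], solved for [m]. *)
    set (m := (Z.of_nat (d1 + d2 + 1) * (N - M) + N - k)%Z).
    assert (Hm : INR (d1 + d2 + 1) * (IZR N * b - IZR M * a) - c0 + INR (d1 + 1) * (b - a) = IZR m * a).
    { unfold m. rewrite minus_IZR, plus_IZR, mult_IZR, minus_IZR, <- INR_IZR_INZ.
      rewrite !plus_INR in *. simpl INR in *. rewrite Ec in Hk. lra. }
    assert (Em : (INR (d1 + d2 + 1) * (IZR N * b - IZR M * a) - c0 + INR (d1 + 1) * (b - a)) / a = IZR m).
    { rewrite Hm. field. lra. }
    rewrite Em in HE. rewrite Ec.
    apply (S_nonempty_of_rotation a b c0 N M Ha Hab Hc0 HN d1 (d1 + d2 + 1) m); trivial.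
    + lia.
    + lra.
    + rewrite !plus_INR in *. simpl INR in *. lra.
    + lra.
Qed.
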